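(* Let $\gamma\ge1$ be real and $\mathcal B$ a finite set of real numbers $\beta$ with $\beta\ge\gamma$ for all $\beta\in\mathcal B$. Let $G_\gamma=(0,\gamma)$ and $H=(0,a)\supset G_\gamma$ be open intervals, let $m$ be a positive integer, and for $s>0$ define $\Lambda_s:C^m(\bar H)\to C^m(\bar H)$ by $$(\Lambda_sf)(x)=\sum_{\beta\in\mathcal B}(x+\beta)^{-2s}f(1/(x+\beta)).$$ Then $\Lambda_s$ has a unique, normalized, strictly positive eigenvector $v_s$, $v_s$ is $C^\infty$, and for all $\nu\ge1$ and $x\in\bar H$, $$0\le(-1)^\nu\frac{D_1^\nu v_s(x)}{v_s(x)}\le\frac{(2s)(2s+1)\cdots(2s+\nu-1)}{\gamma^\nu},$$ where $D_1=d/dx$.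
   Context: $C^m(\bar H)$ is the Banach space of real $C^m$ functions on $H$ whose derivatives of order $\le m$ extend continuously to $\bar H$. *)

(* Defs.v *)
From Stdlib Require Import Reals List.
From Coquelicot Require Import Coquelicot.
Open Scope R_scope.

Definition inClosed (a x : R) : Prop := 0 <= x <= a.
Definition inOpen (a x : R) : Prop := 0 < x < a.

Definition cont_on_closed (a : R) (g : R -> R) : Prop :=
  forall x, inClosed a x ->
    filterlim g (within (inClosed a) (locally x)) (locally (g x)).

Definition deriv_ext (a : R) (f : R -> R) (k : nat) (g : R -> R) : Prop :=
  cont_on_closed a g /\ forall x, inOpen a x -> Derive_n f k x = g x.

(* f belongs to C^m(closure H), H = (0,a): f is m times differentiable on H,
   and every derivative of order <= m extends continuously to [0,a].
   The values of f on [0,a] are the values of that extension (order 0). *)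
Definition CmBar (a : R) (m : nat) (f : R -> R) : Prop :=
  (forall k, (k < m)%nat -> forall x, inOpen a x -> ex_derive (Derive_n f k) x) /\
  cont_on_closed a f /\
  (forall k, (k <= m)%nat -> exists g, deriv_ext a f k g).

(* The operator Lambda_s, B a finite set of reals given as a duplicate-free list. *)
Definition Lambda (B : list R) (s : R) (f : R -> R) (x : R) : R :=
  fold_right Rplus 0 (map (fun b => Rpower (x + b) (-(2 * s)) * f (/ (x + b))) B).

Fixpoint rising (c : R) (n : nat) : R :=
  match n with
  | O => 1
  | S n' => rising c n' * (c + INR n')
  end.

Definition pos_eigvec (B : list R) (s a : R) (m : nat) (v : R -> R) : Prop :=
  CmBar a m v /\ (forall x, inClosed a x -> 0 < v x) /\
  exists lam, forall x, inClosed a x -> Lambda B s v x = lam * v x.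

(* Main.v *)
(* The n-th iterate of Lambda_s is a sum over words of length n of
   (c x + d)^(-2s) f((p x + q) / (c x + d)), where 0 <= gamma c <= d and d >= n.
   Hence the total weight F_n = Lambda_s^n 1 is comparable at different points, F_n(0) is
   sub- and supermultiplicative up to a constant, and some lam satisfies
   F_n(0) ~ lam^n.  The function h = limsup F_n / lam^n is bounded, Lipschitz and
   satisfies Lambda_s h >= lam h, so lam^(-n) Lambda_s^n h increases to an eigenfunction v.

   Since the branches contract, v is also the pointwise limit of the smooth functions
   lam^(-n) sum_w h(q / d) (c x + d)^(-2s), whose nu-th derivatives have sign (-1)^nu and are
   bounded by (2s)_nu (c / (c x + d))^nu <= (2s)_nu / gamma^nu times the function itself;
   boundedness of all derivatives lets them converge pointwise together with the functions.

   If w is another positive eigenfunction, its eigenvalue is lam by comparison with F_n.  With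
   c = min w / v, the eigenfunction w - c v >= 0 vanishes at some x0, hence along all images
   of x0, which approach the images of any other point: so w = c v.

   Everything is done on [-1/2, oo), which the branches map into itself and which contains the
   closure of H in its interior, so that no one-sided derivatives are needed. *)

Require Import Defs.
From Stdlib Require Import Reals List Lra Lia.
From Coquelicot Require Import Coquelicot.
Open Scope R_scope.

(** * Finite sums over lists *)

Definition sumL {A : Type} (f : A -> R) (l : list A) : R :=
  fold_right Rplus 0 (map f l).

Lemma sumL_nil {A} (f : A -> R) : sumL f nil = 0.
Proof. reflexivity. Qed.

Lemma sumL_cons {A} (f : A -> R) x l : sumL f (x :: l) = f x + sumL f l.
Proof. reflexivity. Qed.

Lemma sumL_ext {A} (f g : A -> R) l :
  (forall w, In w l -> f w = g w) -> sumL f l = sumL g l.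
Proof.
  intros H; induction l as [|w l IH]; [reflexivity|].
  rewrite !sumL_cons, IH by (intros; apply H; now right).
  rewrite H by now left. reflexivity.
Qed.

Lemma sumL_le {A} (f g : A -> R) l :
  (forall w, In w l -> f w <= g w) -> sumL f l <= sumL g l.
Proof.
  intros H; induction l as [|w l IH]; [apply Rle_refl|].
  rewrite !sumL_cons. apply Rplus_le_compat.
  - apply H; now left.
  - apply IH; intros; apply H; now right.
Qed.

Lemma sumL_plus {A} (f g : A -> R) l :
  sumL (fun w => f w + g w) l = sumL f l + sumL g l.
Proof.
  induction l as [|w l IH]; [rewrite ?sumL_nil; ring|]. rewrite !sumL_cons, IH; ring.
Qed.

Lemma sumL_scal {A} (k : R) (f : A -> R) l :
  sumL (fun w => k * f w) l = k * sumL f l.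
Proof.
  induction l as [|w l IH]; [rewrite ?sumL_nil; ring|]. rewrite !sumL_cons, IH; ring.
Qed.

Lemma sumL_app {A} (f : A -> R) l l' : sumL f (l ++ l') = sumL f l + sumL f l'.
Proof.
  induction l as [|w l IH]; [cbn [app]; rewrite sumL_nil; ring|].
  cbn [app]. rewrite !sumL_cons, IH; ring.
Qed.

Lemma sumL_map {A B} (h : A -> B) (f : B -> R) l :
  sumL f (map h l) = sumL (fun w => f (h w)) l.
Proof. unfold sumL. now rewrite map_map. Qed.

Lemma sumL_flat_map {A B} (h : A -> list B) (f : B -> R) l :
  sumL f (flat_map h l) = sumL (fun w => sumL f (h w)) l.
Proof.
  induction l as [|w l IH]; [reflexivity|].
  cbn [flat_map]. now rewrite sumL_app, IH, sumL_cons.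
Qed.

Lemma sumL_nonneg {A} (f : A -> R) l :
  (forall w, In w l -> 0 <= f w) -> 0 <= sumL f l.
Proof.
  intros H. replace 0 with (0 * sumL f l) by ring.
  rewrite <- sumL_scal. apply sumL_le. intros w Hw. specialize (H w Hw). lra.
Qed.

Lemma sumL_pos {A} (f : A -> R) l :
  l <> nil -> (forall w, In w l -> 0 < f w) -> 0 < sumL f l.
Proof.
  intros Hl H. destruct l as [|w l]; [easy|]. rewrite sumL_cons.
  apply Rplus_lt_le_0_compat.
  - apply H; now left.
  - apply sumL_nonneg. intros u Hu. left. apply H; now right.
Qed.

Lemma sumL_abs {A} (f : A -> R) l :
  Rabs (sumL f l) <= sumL (fun w => Rabs (f w)) l.
Proof.
  induction l as [|w l IH].
  - rewrite !sumL_nil, Rabs_R0. apply Rle_refl.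
  - rewrite !sumL_cons. eapply Rle_trans; [apply Rabs_triang|]. lra.
Qed.

Lemma is_lim_seq_sumL {A} (f : nat -> A -> R) (g : A -> R) l :
  (forall w, In w l -> is_lim_seq (fun n => f n w) (g w)) ->
  is_lim_seq (fun n => sumL (f n) l) (sumL g l).
Proof.
  intros H; induction l as [|w l IH].
  - apply is_lim_seq_const.
  - apply (is_lim_seq_ext (fun n => f n w + sumL (f n) l)).
    { intros n. now rewrite sumL_cons. }
    rewrite sumL_cons. apply is_lim_seq_plus'.
    + apply H; now left.
    + apply IH. intros; apply H; now right.
Qed.

Lemma is_derive_sumL {A} (f f' : A -> R -> R) l x :
  (forall w, In w l -> is_derive (f w) x (f' w x)) ->
  is_derive (fun y => sumL (fun w => f w y) l) x (sumL (fun w => f' w x) l).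
Proof.
  intros H; induction l as [|w l IH].
  - exact (is_derive_const (K := R_AbsRing) (V := R_NormedModule) 0 x).
  - apply (is_derive_plus (f w) (fun y => sumL (fun u => f u y) l)).
    + apply H; now left.
    + apply IH. intros; apply H; now right.
Qed.

Lemma eventually_forall_in {A} (P : A -> nat -> Prop) l :
  (forall w, In w l -> eventually (P w)) ->
  eventually (fun n => forall w, In w l -> P w n).
Proof.
  intros H; induction l as [|w l IH].
  - exists 0%nat. easy.
  - destruct (H w (or_introl eq_refl)) as [N1 H1].
    destruct IH as [N2 H2]; [intros; apply H; now right|].
    exists (max N1 N2). intros n Hn u [<-|Hu].
    + apply H1; lia.
    + apply H2; [lia|easy].
Qed.

(** * Real analysis *)

Lemma Rpower_neg_antitone (e x y : R) :
  0 <= e -> 0 < x -> x <= y -> Rpower y (- e) <= Rpower x (- e).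
Proof.
  intros He Hx Hxy. rewrite !Rpower_Ropp.
  apply Rinv_le_contravar; [apply exp_pos|].
  now apply Rle_Rpower_l.
Qed.

Lemma Rpower_neg_compare (e C u v : R) :
  0 <= e -> 0 < u -> 0 < v -> 0 < C -> v <= C * u ->
  Rpower u (- e) <= Rpower C e * Rpower v (- e).
Proof.
  intros He Hu Hv HC H.
  apply Rle_trans with (Rpower C e * Rpower (C * u) (- e)).
  - rewrite <- Rpower_mult_distr by lra.
    rewrite <- Rmult_assoc, <- Rpower_plus.
    replace (e + - e) with 0 by ring. rewrite Rpower_O by lra. lra.
  - apply Rmult_le_compat_l; [left; apply exp_pos|].
    apply Rpower_neg_antitone; lra.
Qed.

Lemma pow_neg1_sq (n : nat) : (-1) ^ n * (-1) ^ n = 1.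
Proof. rewrite <- Rpow_mult_distr. replace (-1 * -1) with 1 by ring. apply pow1. Qed.

(** * Growth rate of almost multiplicative sequences *)

Lemma submult_pow (a : nat -> R) n k :
  (forall n, 0 < a n) -> (forall n m, a (n + m)%nat <= a n * a m) ->
  a (n * S k)%nat <= a n ^ S k.
Proof.
  intros Ha Hsub. induction k as [|k IH].
  - rewrite Nat.mul_1_r, pow_1. apply Rle_refl.
  - rewrite Nat.mul_succ_r. eapply Rle_trans; [apply Hsub|].
    rewrite Rmult_comm. change (a n ^ S (S k)) with (a n * a n ^ S k).
    apply Rmult_le_compat_l; [left; apply Ha|exact IH].
Qed.

Lemma supermult_pow (c : R) (a : nat -> R) n k :
  0 < c -> (forall n, 0 < a n) -> (forall n m, c * (a n * a m) <= a (n + m)%nat) ->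
  (c * a n) ^ S k <= c * a (n * S k)%nat.
Proof.
  intros Hc Ha Hsup. pose proof (Ha n). induction k as [|k IH].
  - rewrite Nat.mul_1_r, pow_1. apply Rle_refl.
  - rewrite Nat.mul_succ_r.
    eapply Rle_trans; [|apply Rmult_le_compat_l; [lra|apply Hsup]].
    change ((c * a n) ^ S (S k)) with (c * a n * (c * a n) ^ S k).
    replace (c * (c * (a (n * S k)%nat * a n)))
      with (c * a n * (c * a (n * S k)%nat)) by ring.
    apply Rmult_le_compat_l; [nra|exact IH].
Qed.

Lemma ln_pow_nat (x : R) n : 0 < x -> ln (x ^ n) = INR n * ln x.
Proof. intros Hx. rewrite <- Rpower_pow by easy. unfold Rpower. apply ln_exp. Qed.

Lemma exp_le x y : x <= y -> exp x <= exp y.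
Proof. intros [H| ->]; [left; now apply exp_increasing|apply Rle_refl]. Qed.

(** A two-sided Fekete lemma: [a] is submultiplicative and [c * a] supermultiplicative, so
    estimating [a] at a product of indices in both ways puts every [ln (c * a n) / n] below every
    [ln (a m) / m]. Any number separating the two families is the logarithm of a suitable [l]. *)
Lemma growth_rate (c : R) (a : nat -> R) :
  0 < c -> (forall n, 0 < a n) ->
  (forall n m, a (n + m)%nat <= a n * a m) ->
  (forall n m, c * (a n * a m) <= a (n + m)%nat) ->
  exists l, 0 < l /\ forall n, c * a n <= l ^ n <= a n.
Proof.
  intros Hc Ha Hsub Hsup.
  (* Taking both indices to be 0 settles the exponent 0, where no quotient by the index is
     available, and gives [c <= 1]. *)
  assert (H0 : 1 <= a 0%nat /\ c * a 0%nat <= 1).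
  { pose proof (Ha 0%nat). split; apply (Rmult_le_reg_l (a 0%nat)); try easy.
    - rewrite Rmult_1_r. exact (Hsub 0%nat 0%nat).
    - specialize (Hsup 0%nat 0%nat). cbn [Nat.add] in Hsup. nra. }
  assert (Hc1 : c <= 1) by nra.
  assert (Hln : forall n m, ln (c * a (S n)) / INR (S n) <= ln (a (S m)) / INR (S m)).
  { intros n m.
    pose proof (Ha (S n)) as An. pose proof (Ha (S m)) as Am.
    pose proof (lt_0_INR (S n) ltac:(lia)). pose proof (lt_0_INR (S m) ltac:(lia)).
    apply Rle_div_l; [easy|].
    replace (ln (a (S m)) / INR (S m) * INR (S n))
      with (INR (S n) * ln (a (S m)) / INR (S m)) by (field; lra).
    apply Rle_div_r; [easy|]. rewrite Rmult_comm.
    assert (0 < c * a (S n)) by now apply Rmult_lt_0_compat.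
    rewrite <- !ln_pow_nat by easy. apply ln_le; [now apply pow_lt|].
    eapply Rle_trans; [now apply supermult_pow|].
    apply Rle_trans with (a (S n * S m)%nat).
    - specialize (Ha (S n * S m)%nat). nra.
    - rewrite Nat.mul_comm. now apply submult_pow. }
  (* The supremum of the lower family serves as the separating number. *)
  destruct (completeness (fun y => exists n, y = ln (c * a (S n)) / INR (S n)))
    as [L [Lub Lleast]].
  - exists (ln (a 1%nat) / INR 1). intros y [n ->]. apply Hln.
  - now exists (ln (c * a 1%nat) / INR 1), 0%nat.
  - exists (exp L). split; [apply exp_pos|]. intros [|n].
    { rewrite pow_O. easy. }
    assert (E : exp L ^ S n = exp (INR (S n) * L)).
    { rewrite <- Rpower_pow by apply exp_pos. unfold Rpower. now rewrite ln_exp. }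
    pose proof (lt_0_INR (S n) ltac:(lia)).
    pose proof (Ha (S n)) as An. assert (0 < c * a (S n)) by now apply Rmult_lt_0_compat.
    rewrite E. split.
    + rewrite <- (exp_ln (c * a (S n))) by easy. apply exp_le.
      rewrite (Rmult_comm (INR (S n))). apply Rle_div_l; [easy|]. apply Lub. now exists n.
    + rewrite <- (exp_ln (a (S n))) by easy. apply exp_le.
      rewrite (Rmult_comm (INR (S n))). apply Rle_div_r; [easy|]. apply Lleast.
      intros y [m ->]. apply Hln.
Qed.

(** The bounds exclude the infinite values, so [real] returns the true upper limit and not its
    default 0. *)
Lemma LimSup_bounded (u : nat -> R) (m M : R) :
  (forall n, m <= u n <= M) ->
  is_LimSup_seq u (real (LimSup_seq u)) /\ m <= real (LimSup_seq u) <= M.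
Proof.
  intros H. destruct (ex_LimSup_seq u) as [[l| |] Hl].
  - rewrite (is_LimSup_seq_unique _ _ Hl). split; [easy|]. cbn. split.
    + apply le_epsilon. intros e He.
      destruct (Hl (mkposreal e He)) as [_ [N HN]].
      specialize (HN N (le_n N)). cbn in HN. specialize (H N). lra.
    + apply le_epsilon. intros e He.
      destruct (Hl (mkposreal e He)) as [HN _].
      destruct (HN 0%nat) as [n [_ Hn]]. cbn in Hn. specialize (H n). lra.
  - destruct (Hl M 0%nat) as [n [_ Hn]]. specialize (H n). lra.
  - destruct (Hl m) as [N HN]. specialize (HN N (le_n N)). specialize (H N). lra.
Qed.

Lemma LimSup_le_shift (u w : nat -> R) (l l' k : R) :
  is_LimSup_seq u l -> is_LimSup_seq w l' -> (forall n, u n <= w n + k) -> l <= l' + k.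
Proof.
  intros Hu Hw H. apply le_epsilon. intros e He.
  assert (He2 : 0 < e / 2) by lra.
  destruct (Hu (mkposreal _ He2)) as [Hinf _].
  destruct (Hw (mkposreal _ He2)) as [_ [N HN]].
  destruct (Hinf N) as [n [Hn Hun]]. specialize (HN n Hn). specialize (H n).
  cbn in *. lra.
Qed.

(** * Derivatives of pointwise limits *)

Lemma MVT_bound (f f' : R -> R) (K x y : R) :
  (forall z, Rmin x y <= z <= Rmax x y -> is_derive f z (f' z)) ->
  (forall z, Rmin x y <= z <= Rmax x y -> Rabs (f' z) <= K) ->
  Rabs (f y - f x) <= K * Rabs (y - x).
Proof.
  intros Hd HK. destruct (MVT_gen f x y f') as [c [Hc E]].
  - intros z Hz. apply Hd. lra.
  - intros z Hz. apply derivable_continuous_pt.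
    exists (f' z). now apply is_derive_Reals, Hd.
  - rewrite E, Rabs_mult. apply Rmult_le_compat_r; [apply Rabs_pos|]. now apply HK.
Qed.

(** The mean value theorem is applied to [f] and then to [f'] between [x] and the intermediate
    point; this gives [K] in place of the sharp [K / 2]. *)
Lemma Taylor1_bound (f f' f'' : R -> R) (r K x y : R) :
  (forall z, r < z -> is_derive f z (f' z)) ->
  (forall z, r < z -> is_derive f' z (f'' z)) ->
  (forall z, r < z -> Rabs (f'' z) <= K) ->
  r < x -> r < y ->
  Rabs (f y - f x - f' x * (y - x)) <= K * (y - x) ^ 2.
Proof.
  intros Hd Hd' HK Hx Hy.
  destruct (MVT_gen f x y f') as [c [Hc E]].
  - intros z Hz. apply Hd. pose proof (Rmin_glb_lt x y r Hx Hy). lra.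
  - intros z Hz. apply derivable_continuous_pt.
    exists (f' z). apply is_derive_Reals, Hd.
    pose proof (Rmin_glb_lt x y r Hx Hy). lra.
  - pose proof (Rmin_glb_lt x y r Hx Hy).
    assert (K0 : 0 <= K) by (eapply Rle_trans; [apply Rabs_pos|apply (HK x Hx)]).
    assert (B : Rabs (f' c - f' x) <= K * Rabs (c - x)).
    { pose proof (Rmin_glb_lt x c r Hx ltac:(lra)).
      apply (MVT_bound f' f''); intros z Hz; [apply Hd'|apply HK]; lra. }
    assert (C : Rabs (c - x) <= Rabs (y - x)).
    { unfold Rmin, Rmax in *. destruct (Rle_dec x y); apply Rabs_le_between;
      unfold Rabs; destruct (Rcase_abs (y - x)); lra. }
    rewrite E. replace (f' c * (y - x) - f' x * (y - x))
      with ((f' c - f' x) * (y - x)) by ring.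
    rewrite Rabs_mult, <- pow2_abs.
    replace (K * Rabs (y - x) ^ 2) with (K * Rabs (y - x) * Rabs (y - x)) by ring.
    apply Rmult_le_compat_r; [apply Rabs_pos|].
    eapply Rle_trans; [exact B|]. now apply Rmult_le_compat_l.
Qed.

Lemma is_derive_quadratic (f : R -> R) (r K x l : R) :
  r < x -> (forall y, r < y -> Rabs (f y - f x - l * (y - x)) <= K * (y - x) ^ 2) ->
  is_derive f x l.
Proof.
  intros Hx H. apply is_derive_Reals. intros e He.
  assert (K0 : 0 <= K).
  { specialize (H (x + 1) ltac:(lra)). replace (x + 1 - x) with 1 in H by ring.
    rewrite pow1, !Rmult_1_r in H. eapply Rle_trans; [apply Rabs_pos|]. exact H. }
  (* The first radius makes [K * Rabs t] smaller than [e]; the second keeps [x + t] to the right of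
     [r]. *)
  assert (Hd : 0 < Rmin (e / (K + 1)) (x - r)).
  { apply Rmin_glb_lt; [apply Rdiv_lt_0_compat; lra|lra]. }
  exists (mkposreal _ Hd). intros t Ht0 Ht. cbn in Ht.
  pose proof (Rlt_le_trans _ _ _ Ht (Rmin_l _ _)) as T1.
  pose proof (Rlt_le_trans _ _ _ Ht (Rmin_r _ _)) as T2.
  apply Rabs_def2 in T2.
  specialize (H (x + t) ltac:(lra)). replace (x + t - x) with t in H by ring.
  replace ((f (x + t) - f x) / t - l) with ((f (x + t) - f x - l * t) / t) by (now field).
  pose proof (Rabs_pos_lt t Ht0) as Tp.
  unfold Rdiv. rewrite Rabs_mult, Rabs_inv. apply Rlt_div_l; [easy|].
  eapply Rle_lt_trans; [exact H|]. rewrite <- pow2_abs.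
  replace (K * Rabs t ^ 2) with (K * Rabs t * Rabs t) by ring.
  apply Rmult_lt_compat_r; [easy|].
  apply Rlt_div_r in T1; [|lra]. nra.
Qed.

(** A difference quotient of step [t] approximates [f' n x] with an error of at most [K * t] for all
    [n] at once, and for fixed [t] these quotients converge. Hence the derivatives form a Cauchy
    sequence. *)
Lemma ex_lim_derive (f f' f'' : nat -> R -> R) (r K x : R) :
  (forall n z, r < z -> is_derive (f n) z (f' n z)) ->
  (forall n z, r < z -> is_derive (f' n) z (f'' n z)) ->
  (forall n z, r < z -> Rabs (f'' n z) <= K) ->
  (forall z, r < z -> ex_finite_lim_seq (fun n => f n z)) ->
  r < x -> ex_finite_lim_seq (fun n => f' n x).
Proof.
  intros Hd Hd' HK Hlim Hx. apply ex_lim_seq_cauchy_corr. intros [e He]. cbn.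
  assert (K0 : 0 <= K) by (eapply Rle_trans; [apply Rabs_pos|apply (HK 0%nat x Hx)]).
  (* After multiplication by [t], the two Taylor errors cost at most [e * t / 2] and the two Cauchy
     errors at most [e * t / 4], which leaves room below [e * t]. *)
  set (t := e / (4 * (K + 1))).
  assert (Ht : 0 < t) by (apply Rdiv_lt_0_compat; lra).
  assert (HtK : K * t ^ 2 <= e / 4 * t).
  { replace (e / 4) with ((K + 1) * t) by (unfold t; field; lra). nra. }
  assert (Hx' : r < x + t) by lra.
  assert (Het : 0 < e * t / 8) by nra.
  destruct (proj1 (ex_lim_seq_cauchy_corr _) (Hlim x Hx) (mkposreal _ Het)) as [N1 C1].
  destruct (proj1 (ex_lim_seq_cauchy_corr _) (Hlim (x + t) Hx') (mkposreal _ Het)) as [N2 C2].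
  exists (max N1 N2). intros n m Hn Hm.
  specialize (C1 n m ltac:(lia) ltac:(lia)). specialize (C2 n m ltac:(lia) ltac:(lia)).
  pose proof (Taylor1_bound _ _ _ r K x (x + t) (Hd n) (Hd' n) (HK n) Hx Hx') as Tn.
  pose proof (Taylor1_bound _ _ _ r K x (x + t) (Hd m) (Hd' m) (HK m) Hx Hx') as Tm.
  replace (x + t - x) with t in Tn, Tm by ring.
  cbn in C1, C2. apply Rabs_def2 in C1. apply Rabs_def2 in C2.
  apply Rabs_le_between in Tn. apply Rabs_le_between in Tm.
  apply (Rmult_lt_reg_r t); [easy|].
  rewrite <- (Rabs_pos_eq t) at 1 by lra. rewrite <- Rabs_mult.
  apply Rabs_def1; nra.
Qed.

Lemma lim_seq_le_real (u w : nat -> R) (l l' : R) :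
  (forall n, u n <= w n) -> is_lim_seq u l -> is_lim_seq w l' -> l <= l'.
Proof. intros H Hu Hw. exact (is_lim_seq_le u w l l' H Hu Hw). Qed.

(** Pointwise convergence suffices: the bound on order [k + 2] makes the quadratic Taylor error at
    order [k] uniform in [n], so the estimate passes to the limit and identifies its derivative. *)
Lemma lim_derivs (G : nat -> nat -> R -> R) (K : nat -> R) (r : R) :
  (forall n k x, r < x -> is_derive (G n k) x (G n (S k) x)) ->
  (forall n k x, r < x -> Rabs (G n k x) <= K k) ->
  (forall x, r < x -> ex_finite_lim_seq (fun n => G n 0%nat x)) ->
  forall k x, r < x ->
    is_lim_seq (fun n => G n k x) (real (Lim_seq (fun n => G n k x))) /\
    is_derive (fun y => real (Lim_seq (fun n => G n k y))) x
      (real (Lim_seq (fun n => G n (S k) x))).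
Proof.
  intros Hd HK H0.
  assert (Hex : forall k x, r < x -> ex_finite_lim_seq (fun n => G n k x)).
  { induction k as [|k IH]; [exact H0|]. intros x Hx.
    apply (ex_lim_derive (fun n => G n k) (fun n => G n (S k)) (fun n => G n (S (S k)))
      r (K (S (S k)))); auto. }
  assert (Hlim : forall k x, r < x ->
    is_lim_seq (fun n => G n k x) (real (Lim_seq (fun n => G n k x)))).
  { intros k x Hx. apply Lim_seq_correct', Hex, Hx. }
  intros k x Hx. split; [now apply Hlim|].
  apply (is_derive_quadratic _ r (K (S (S k)))); [easy|]. intros y Hy.
  eapply (lim_seq_le_real (fun n => Rabs (G n k y - G n k x - G n (S k) x * (y - x)))
    (fun _ => K (S (S k)) * (y - x) ^ 2)).
  - intros n. apply (Taylor1_bound (G n k) (G n (S k)) (G n (S (S k))) r); auto.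
  - apply (is_lim_seq_abs _ (Finite _)).
    apply is_lim_seq_minus'; [apply is_lim_seq_minus'; apply Hlim; easy|].
    apply is_lim_seq_mult'; [now apply Hlim|apply is_lim_seq_const].
  - apply is_lim_seq_const.
Qed.

Lemma pow_growth_le (x y c C : R) :
  0 < x -> 0 < y -> 0 < c -> (forall n, c * x ^ n <= C * y ^ n) -> x <= y.
Proof.
  intros Hx Hy Hc H. apply Rnot_lt_le. intros Hyx.
  assert (HC : 0 < C) by (specialize (H 0%nat); rewrite !pow_O in H; lra).
  assert (Hr : 0 < y / x < 1)
    by (split; [now apply Rdiv_lt_0_compat|apply Rlt_div_l; lra]).
  destruct (pow_lt_1_zero (y / x)) with (y := c / C) as [N HN].
  - rewrite Rabs_pos_eq; lra.
  - now apply Rdiv_lt_0_compat.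
  - specialize (HN N (le_n N)). specialize (H N).
    pose proof (pow_lt x N Hx). pose proof (pow_lt y N Hy).
    rewrite Rabs_pos_eq in HN by (apply pow_le; lra).
    unfold Rdiv in HN at 1. rewrite Rpow_mult_distr, pow_inv in HN.
    apply Rlt_div_r in HN; [|easy].
    assert (y ^ N * / x ^ N * C * x ^ N < c * x ^ N) by now apply Rmult_lt_compat_r.
    replace (y ^ N * / x ^ N * C * x ^ N) with (C * y ^ N) in * by (field; lra).
    lra.
Qed.

(** The retraction of the line onto [[0, a]]. Composition with it turns continuity relative to
    [[0, a]] into two-sided continuity, the form in which the extreme value theorem is applied. *)
Definition clamp (a x : R) : R := Rmax 0 (Rmin x a).

Lemma clamp_id a x : inClosed a x -> clamp a x = x.
Proof.
  intros [H0 H1]. unfold clamp. rewrite Rmin_left, Rmax_right; easy.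
Qed.

Lemma clamp_continuous a f x :
  0 <= a -> cont_on_closed a f -> continuity_pt (fun y => f (clamp a y)) x.
Proof.
  intros Ha Hf. apply continuity_pt_filterlim.
  assert (Hcl : forall y, inClosed a (clamp a y)).
  { intros y. unfold inClosed, clamp, Rmax, Rmin.
    destruct (Rle_dec y a); destruct (Rle_dec 0 _); lra. }
  apply (filterlim_comp _ _ _ (clamp a) f (locally x)
    (within (inClosed a) (locally (clamp a x)))); [|now apply Hf].
  intros P [e He]. exists e. intros y Hy. apply He; [|easy].
  eapply Rle_lt_trans; [|exact Hy].
  unfold abs, minus, plus, opp; cbn. unfold clamp, Rmax, Rmin, Rabs.
  destruct (Rle_dec y a), (Rle_dec x a);
    repeat destruct (Rle_dec _ _); repeat destruct (Rcase_abs _); lra.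
Qed.

(** * Iterates of the transfer operator *)

(* A branch [Br c d p q] stands for the inverse branch x |-> (p x + q) / (c x + d)
   of a product of the matrices ((0, 1), (1, b)). *)
Record branch : Type := Br { bc : R; bd : R; bp : R; bq : R }.

Definition den (w : branch) (x : R) : R := bc w * x + bd w.
Definition mob (w : branch) (x : R) : R := (bp w * x + bq w) / den w x.

(** Multiplication by ((0, 1), (1, b)) on the right, that is, precomposition of [mob w] with
    [x |-> / (x + b)]. *)
Definition step (b : R) (w : branch) : branch :=
  Br (bd w) (bc w + bd w * b) (bq w) (bp w + bq w * b).

Fixpoint words (B : list R) (n : nat) : list branch :=
  match n with
  | O => Br 0 1 1 0 :: nil
  | S n' => flat_map (fun b => map (step b) (words B n')) B
  end.

(** The closed form of the [n]-th power of [Lambda B s], justified on [[-1/2, oo)] by [iter_0] and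
    [iter_S]. *)
Definition iter (B : list R) (s : R) (n : nat) (f : R -> R) (x : R) : R :=
  sumL (fun w => Rpower (den w x) (- (2 * s)) * f (mob w x)) (words B n).

(* [good_low] keeps [mob w] inside [-1/2, oo) on [-1/2, oo). *)
Record good (gamma : R) (n : nat) (w : branch) : Prop := {
  good_c : 0 <= bc w;
  good_p : 0 <= bp w;
  good_q : 0 <= bq w;
  good_gamma : gamma * bc w <= bd w;
  good_d : 1 <= bd w;
  good_qd : bq w <= bd w;
  good_pq : bp w + bq w <= bc w + bd w;
  good_low : 2 * bp w + bc w <= 4 * bq w + 2 * bd w;
  good_det : (bp w * bd w - bq w * bc w) ^ 2 = 1;
  good_depth : INR n <= bd w;
  good_c1 : (0 < n)%nat -> 1 <= bc w
}.

Section Transfer.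

Variables (gamma s : R) (B : list R).
Hypothesis Hgamma : 1 <= gamma.
Hypothesis Hs : 0 < s.
Hypothesis HB : B <> nil.
Hypothesis HBg : List.Forall (fun b => gamma <= b) B.

Lemma B_ge b : In b B -> gamma <= b.
Proof. revert b. now apply Forall_forall. Qed.

(** Each inequality of [good] survives [step] because [b >= gamma >= 1]. The depth bound gains one
    at each letter since the new [bd] is [bc + bd * b], with [bc >= 1] as soon as the word is
    nonempty. *)
Lemma words_good n w : In w (words B n) -> good gamma n w.
Proof.
  revert w; induction n as [|n IH]; intros w Hw.
  - destruct Hw as [<-|[]]. constructor; cbn; try lra; try nra. lia.
  - cbn in Hw. apply in_flat_map in Hw as [b [Hb Hw]].
    apply in_map_iff in Hw as [u [<- Hu]].
    apply B_ge in Hb. destruct (IH u Hu) as [H1 H2 H3 H4 H5 H6 H7 H8 H9 H10 H11].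
    assert (Hd : bd u * 1 <= bd u * b) by (apply Rmult_le_compat_l; lra).
    assert (Hdg : bd u * gamma <= bd u * b) by (apply Rmult_le_compat_l; lra).
    assert (Hq : bq u * 1 <= bq u * b) by (apply Rmult_le_compat_l; lra).
    assert (Hqd : bq u * (b - 1) <= bd u * (b - 1)) by (apply Rmult_le_compat_r; lra).
    constructor; cbn [step bc bd bp bq]; try lra.
    rewrite S_INR. destruct n as [|n].
    - cbn. lra.
    - specialize (H11 ltac:(lia)). lra.
Qed.

Lemma words_nonempty n : words B n <> nil.
Proof.
  clear HBg. induction n as [|n IH]; [easy|]. cbn. destruct B as [|b l]; [easy|].
  cbn. destruct (words (b :: l) n); easy.
Qed.

Lemma c_le_d n w : good gamma n w -> bc w <= bd w.
Proof.
  intros [H1 _ _ H4 _ _ _ _ _ _ _].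
  assert (1 * bc w <= gamma * bc w) by (apply Rmult_le_compat_r; lra). lra.
Qed.

Lemma den_ge_half n w x : good gamma n w -> - (1/2) <= x -> bd w / 2 <= den w x.
Proof.
  intros Hw Hx. pose proof (c_le_d _ _ Hw).
  destruct Hw as [H1 _ _ _ _ _ _ _ _ _ _]. unfold den.
  assert (bc w * - (1/2) <= bc w * x) by (apply Rmult_le_compat_l; lra). lra.
Qed.

Lemma den_pos n w x : good gamma n w -> - (1/2) <= x -> 0 < den w x.
Proof.
  intros Hw Hx. pose proof (den_ge_half _ _ _ Hw Hx).
  pose proof (good_d _ _ _ Hw). lra.
Qed.

Lemma mob_ge_half n w x : good gamma n w -> - (1/2) <= x -> - (1/2) <= mob w x.
Proof.
  intros Hw Hx. pose proof (den_pos _ _ _ Hw Hx) as Hden.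
  destruct Hw as [H1 H2 H3 H4 H5 H6 H7 H8 H9 H10 H11].
  unfold mob. apply Rle_div_r; [easy|]. unfold den in *.
  (* The cleared inequality is increasing in [x], and at [x = -1/2] it is exactly [good_low]. *)
  assert ((bp w + bc w / 2) * - (1/2) <= (bp w + bc w / 2) * x)
    by (apply Rmult_le_compat_l; lra). lra.
Qed.

Lemma mob_nonneg n w x : good gamma n w -> 0 <= x -> 0 <= mob w x.
Proof.
  intros Hw Hx. assert (Hden : 0 < den w x) by (eapply den_pos; [eassumption|lra]).
  destruct Hw as [H1 H2 H3 H4 H5 H6 H7 H8 H9 H10 H11].
  unfold mob. apply Rle_div_r; [easy|]. nra.
Qed.

Lemma mob_le n w a x : good gamma n w -> 1 <= a -> 0 <= x <= a -> mob w x <= a.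
Proof.
  intros Hw Ha Hx. assert (Hden : 0 < den w x) by (eapply den_pos; [eassumption|lra]).
  destruct Hw as [H1 H2 H3 H4 H5 H6 H7 H8 H9 H10 H11].
  unfold mob. apply Rle_div_l; [easy|]. unfold den.
  (* The difference [a * den w x - (bp w * x + bq w)] is affine in [x]; [E0] and [Ea] are its signs
     at 0 and at [a], and interpolation gives the rest. *)
  assert (E0 : 0 <= a * bd w - bq w) by nra.
  assert (Ea : 0 <= a * bc w * a + a * bd w - bp w * a - bq w).
  { assert (0 <= (a - 1) * (bc w + bd w - bp w)) by (apply Rmult_le_pos; lra).
    assert (0 <= bc w * (a - 1) * a) by (apply Rmult_le_pos; [apply Rmult_le_pos|]; lra).
    nra. }
  assert (0 <= (a - x) * (a * bd w - bq w)) by (apply Rmult_le_pos; lra).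
  assert (0 <= x * (a * bc w * a + a * bd w - bp w * a - bq w))
    by (apply Rmult_le_pos; lra).
  apply (Rmult_le_reg_l a); nra.
Qed.

(** As the determinant is 1 or -1, the images differ by [(x - y) / (den w x * den w y)] up to sign.
    Both denominators are at least [bd w / 2], and [INR n <= bd w <= bd w ^ 2], whence the factor
    4. *)
Lemma mob_dist n w x y :
  good gamma n w -> - (1/2) <= x -> - (1/2) <= y ->
  INR n * Rabs (mob w x - mob w y) <= 4 * Rabs (x - y).
Proof.
  intros Hw Hx Hy.
  pose proof (den_pos _ _ _ Hw Hx) as Px. pose proof (den_pos _ _ _ Hw Hy) as Py.
  pose proof (den_ge_half _ _ _ Hw Hx) as Gx. pose proof (den_ge_half _ _ _ Hw Hy) as Gy.
  destruct Hw as [H1 H2 H3 H4 H5 H6 H7 H8 H9 H10 H11].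
  assert (E : mob w x - mob w y
      = (bp w * bd w - bq w * bc w) * ((x - y) / (den w x * den w y))).
  { unfold mob. unfold den in *. field. lra. }
  assert (D : Rabs (bp w * bd w - bq w * bc w) = 1).
  { rewrite <- (sqrt_Rsqr (Rabs _)) by apply Rabs_pos.
    rewrite <- Rsqr_abs. replace (Rsqr _) with ((bp w * bd w - bq w * bc w) ^ 2)
      by (unfold Rsqr; ring).
    rewrite H9. apply sqrt_1. }
  assert (Pxy : 0 < den w x * den w y) by now apply Rmult_lt_0_compat.
  rewrite E, Rabs_mult, D, Rmult_1_l. unfold Rdiv at 1.
  rewrite Rabs_mult, (Rabs_pos_eq (/ _)) by (left; now apply Rinv_0_lt_compat).
  replace (INR n * (Rabs (x - y) * / (den w x * den w y)))
    with (INR n / (den w x * den w y) * Rabs (x - y)) by (field; lra).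
  apply Rmult_le_compat_r; [apply Rabs_pos|].
  apply Rle_div_l; [easy|].
  assert (bd w / 2 * (bd w / 2) <= den w x * den w y)
    by (apply Rmult_le_compat; lra).
  nra.
Qed.

(** * The operator and the closed form of its iterates *)

Lemma Lambda_ext f g x :
  (forall b, In b B -> f (/ (x + b)) = g (/ (x + b))) ->
  Lambda B s f x = Lambda B s g x.
Proof. intros H. apply sumL_ext. intros b Hb. now rewrite H. Qed.

Lemma Lambda_le f g x :
  (forall b, In b B -> f (/ (x + b)) <= g (/ (x + b))) ->
  Lambda B s f x <= Lambda B s g x.
Proof.
  intros H. apply sumL_le. intros b Hb. apply Rmult_le_compat_l.
  - left; apply exp_pos.
  - now apply H.
Qed.

Lemma Lambda_scal k f x : Lambda B s (fun y => k * f y) x = k * Lambda B s f x.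
Proof.
  unfold Lambda. change (fold_right Rplus 0 (map ?h ?l)) with (sumL h l).
  change (fold_right Rplus 0 (map ?h ?l)) with (sumL h l).
  rewrite <- sumL_scal. apply sumL_ext. intros; ring.
Qed.

Lemma inv_branch_range x b :
  In b B -> - (1/2) <= x -> 0 < / (x + b) /\ (0 <= x -> / (x + b) <= 1).
Proof.
  intros Hb Hx. apply B_ge in Hb. split.
  - apply Rinv_0_lt_compat; lra.
  - intros H0. rewrite <- Rinv_1. apply Rinv_le_contravar; lra.
Qed.

Lemma iter_0 f x : iter B s 0 f x = f x.
Proof.
  unfold iter, sumL, den, mob; cbn. unfold den; cbn.
  replace (0 * x + 1) with 1 by ring.
  replace ((1 * x + 0) / 1) with x by field.
  unfold Rpower. rewrite ln_1, Rmult_0_r, exp_0. ring.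
Qed.

Lemma iter_S n f x : - (1/2) <= x ->
  iter B s (S n) f x = Lambda B s (iter B s n f) x.
Proof.
  intros Hx. unfold iter, Lambda. cbn [words].
  change (fold_right Rplus 0 (map ?h ?l)) with (sumL h l).
  rewrite sumL_flat_map. apply sumL_ext. intros b Hb.
  rewrite sumL_map, <- sumL_scal. apply sumL_ext. intros w Hw.
  apply words_good in Hw. pose proof (inv_branch_range x b Hb Hx) as [Hi _].
  assert (Hden : 0 < den w (/ (x + b))) by (apply (den_pos n); [easy|lra]).
  apply B_ge in Hb.
  (* This cocycle identity splits the weight of the longer word into the factor from [Lambda] and
     the weight of [w] at the image point. *)
  assert (E : den (step b w) x = (x + b) * den w (/ (x + b)))
    by (unfold den, step; cbn; field; lra).
  assert (E' : mob (step b w) x = mob w (/ (x + b))).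
  { unfold mob. rewrite E. unfold step; cbn. field. lra. }
  rewrite E', E, <- Rpower_mult_distr by lra. ring.
Qed.

Lemma iter_le n f g x :
  (forall w, In w (words B n) -> f (mob w x) <= g (mob w x)) ->
  iter B s n f x <= iter B s n g x.
Proof.
  intros H. apply sumL_le. intros w Hw. apply Rmult_le_compat_l.
  - left; apply exp_pos.
  - now apply H.
Qed.

Lemma iter_const n k x : iter B s n (fun _ => k) x = k * iter B s n (fun _ => 1) x.
Proof.
  unfold iter. rewrite <- sumL_scal. apply sumL_ext. intros; ring.
Qed.

Lemma iter_add n m f x : - (1/2) <= x ->
  iter B s (n + m) f x = iter B s n (iter B s m f) x.
Proof.
  revert x; induction n as [|n IH]; intros x Hx.
  - now rewrite iter_0.
  - cbn [Nat.add]. rewrite !iter_S by easy. apply Lambda_ext. intros b Hb.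
    apply IH. pose proof (inv_branch_range x b Hb Hx). lra.
Qed.

(** * Total weights and their distortion *)

Definition weight (n : nat) (x : R) : R := iter B s n (fun _ => 1) x.

Lemma weight_eq n x : weight n x = sumL (fun w => Rpower (den w x) (- (2 * s))) (words B n).
Proof. apply sumL_ext. intros; ring. Qed.

Lemma weight_pos n x : 0 < weight n x.
Proof.
  rewrite weight_eq. apply sumL_pos; [apply words_nonempty|].
  intros; apply exp_pos.
Qed.

Lemma weight_antitone n x y : - (1/2) <= x -> x <= y -> weight n y <= weight n x.
Proof.
  intros Hx Hxy. rewrite !weight_eq. apply sumL_le. intros w Hw.
  apply words_good in Hw. apply Rpower_neg_antitone; [lra|now apply (den_pos n)|].
  pose proof (good_c _ _ _ Hw). unfold den.
  apply Rplus_le_compat_r, Rmult_le_compat_l; lra.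
Qed.

(** Written as [bc w * (1 + x) + (bd w - bc w)] with both coefficients nonnegative, a denominator
    changes by at most the factor [C], whatever the word and its length. *)
Lemma weight_compare n C x y : - (1/2) <= x -> - (1/2) <= y -> 0 < C ->
  1 + y <= C * (1 + x) -> 1 <= C -> weight n x <= Rpower C (2 * s) * weight n y.
Proof.
  intros Hx Hy HC Hxy HC1. rewrite !weight_eq, <- sumL_scal. apply sumL_le. intros w Hw.
  apply words_good in Hw.
  apply Rpower_neg_compare; [lra|now apply (den_pos n)|now apply (den_pos n)|easy|].
  pose proof (c_le_d _ _ Hw). destruct Hw as [H1 H2 H3 H4 H5 H6 H7 H8 H9 H10 H11].
  unfold den.
  replace (bc w * y + bd w) with (bc w * (1 + y) + (bd w - bc w)) by ring.
  replace (C * (bc w * x + bd w))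
    with (bc w * (C * (1 + x)) + C * (bd w - bc w)) by ring.
  apply Rplus_le_compat.
  - now apply Rmult_le_compat_l.
  - nra.
Qed.

(** The distortion of the weights over [[0, 1]], where [1 + x] at most doubles. *)
Definition kappa : R := / Rpower 2 (2 * s).

Lemma kappa_pos : 0 < kappa.
Proof. apply Rinv_0_lt_compat, exp_pos. Qed.

Lemma mob0_range n w : good gamma n w -> 0 <= mob w 0 <= 1.
Proof.
  intros [H1 H2 H3 H4 H5 H6 H7 H8 H9 H10 H11]. unfold mob, den.
  replace (bp w * 0 + bq w) with (bq w) by ring.
  replace (bc w * 0 + bd w) with (bd w) by ring.
  split; [apply Rle_div_r|apply Rle_div_l]; lra.
Qed.

(** The outer iterate at 0 evaluates [weight m] only at points of [[0, 1]], where it lies between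
    [kappa * weight m 0] and [weight m 0]. The upper bound is used here, the lower one in
    [weight0_supermult]. *)
Lemma weight0_submult n m : weight (n + m) 0 <= weight n 0 * weight m 0.
Proof.
  unfold weight at 1. rewrite iter_add by lra. rewrite Rmult_comm.
  change (weight n 0) with (iter B s n (fun _ => 1) 0).
  rewrite <- (iter_const n (weight m 0)). apply iter_le.
  intros w Hw. apply words_good, mob0_range in Hw. apply weight_antitone; lra.
Qed.

Lemma weight0_supermult n m : kappa * (weight n 0 * weight m 0) <= weight (n + m) 0.
Proof.
  unfold weight at 3. rewrite iter_add by lra.
  replace (kappa * (weight n 0 * weight m 0)) with (kappa * weight m 0 * weight n 0) by ring.
  unfold weight at 2. rewrite <- (iter_const n (kappa * weight m 0)). apply iter_le.
  intros w Hw. apply words_good, mob0_range in Hw. unfold kappa.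
  apply (Rmult_le_reg_l (Rpower 2 (2 * s))); [apply exp_pos|].
  rewrite <- Rmult_assoc, Rinv_r, Rmult_1_l by apply Rgt_not_eq, exp_pos.
  apply weight_compare; lra.
Qed.

(** * Derivatives of weighted sums over words *)

Lemma is_derive_Rpower_den w n e x : good gamma n w -> - (1/2) <= x ->
  is_derive (fun y => Rpower (den w y) e) x (e * (bc w * Rpower (den w x) (e - 1))).
Proof.
  intros Hw Hx. pose proof (den_pos _ _ _ Hw Hx) as Hd. unfold Rpower, den in *.
  auto_derive; [easy|].
  replace ((e - 1) * ln (bc w * x + bd w))
    with (e * ln (bc w * x + bd w) + - ln (bc w * x + bd w)) by ring.
  rewrite exp_plus, exp_Ropp, exp_ln by easy. field. lra.
Qed.

(** The derivative of order [nu] of the sum of [k w * Rpower (den w x) (- (2 * s))]. The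
    coefficients do not depend on [x]: they are 1 for the total weight and values of [hsup] for the
    approximations. *)
Definition wder (k : branch -> R) (n nu : nat) (x : R) : R :=
  (-1) ^ nu * rising (2 * s) nu *
  sumL (fun w => k w * (bc w ^ nu * Rpower (den w x) (- (2 * s) - INR nu))) (words B n).

Lemma wder_0 k n x :
  wder k n 0 x = sumL (fun w => Rpower (den w x) (- (2 * s)) * k w) (words B n).
Proof.
  unfold wder. cbn [rising]. rewrite pow_O, !Rmult_1_l. apply sumL_ext. intros w _.
  rewrite pow_O. replace (- (2 * s) - INR 0) with (- (2 * s)) by (cbn; ring). ring.
Qed.

Lemma is_derive_wder k n nu x : - (1/2) <= x ->
  is_derive (wder k n nu) x (wder k n (S nu) x).
Proof.
  intros Hx. unfold wder.
  replace ((-1) ^ S nu * rising (2 * s) (S nu) * _) with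
    ((-1) ^ nu * rising (2 * s) nu *
     sumL (fun w => k w * (bc w ^ nu *
       ((- (2 * s) - INR nu) * (bc w * Rpower (den w x) (- (2 * s) - INR nu - 1)))))
     (words B n)).
  - apply is_derive_scal.
    apply (is_derive_sumL
      (fun w y => k w * (bc w ^ nu * Rpower (den w y) (- (2 * s) - INR nu)))
      (fun w y => k w * (bc w ^ nu *
       ((- (2 * s) - INR nu) * (bc w * Rpower (den w y) (- (2 * s) - INR nu - 1)))))).
    intros w Hw. apply is_derive_scal, is_derive_scal.
    apply (is_derive_Rpower_den w n); [now apply words_good|easy].
  - transitivity ((-1) ^ nu * rising (2 * s) nu * ((- (2 * s) - INR nu) *
      sumL (fun w => k w * (bc w ^ S nu * Rpower (den w x) (- (2 * s) - INR (S nu))))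
        (words B n))).
    + f_equal. rewrite <- sumL_scal. apply sumL_ext. intros w _.
      replace (- (2 * s) - INR (S nu)) with (- (2 * s) - INR nu - 1)
        by (rewrite S_INR; ring).
      cbn [pow]. ring.
    + cbn [rising pow]. ring.
Qed.

Lemma rising_pos c n : 0 < c -> 0 < rising c n.
Proof.
  intros Hc. induction n as [|n IH]; cbn [rising]; [lra|].
  apply Rmult_lt_0_compat; [easy|]. pose proof (pos_INR n). lra.
Qed.

(** Term by term, each differentiation contributes a factor [bc w / den w x <= r]. The choice
    [r = 2] works on [[-1/2, oo)] and [r = / gamma] on [[0, oo)]. *)
Lemma wder_bound k n nu x r :
  (forall w, In w (words B n) -> 0 <= k w) ->
  (forall w, In w (words B n) -> bc w <= r * den w x) ->
  - (1/2) <= x ->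
  0 <= (-1) ^ nu * wder k n nu x <= rising (2 * s) nu * r ^ nu * wder k n 0 x.
Proof.
  intros Hk Hr Hx. pose proof (rising_pos (2 * s) nu ltac:(lra)) as Hris.
  rewrite wder_0. unfold wder.
  rewrite <- !Rmult_assoc, pow_neg1_sq, Rmult_1_l. split.
  - apply Rmult_le_pos; [lra|]. apply sumL_nonneg. intros w Hw.
    pose proof (Hk w Hw). apply words_good in Hw. pose proof (good_c _ _ _ Hw).
    apply Rmult_le_pos; [easy|]. apply Rmult_le_pos; [now apply pow_le|].
    left; apply exp_pos.
  - rewrite Rmult_assoc. apply Rmult_le_compat_l; [lra|].
    rewrite <- sumL_scal. apply sumL_le. intros w Hw.
    pose proof (Hk w Hw). pose proof (Hr w Hw) as Hrw.
    apply words_good in Hw. pose proof (good_c _ _ _ Hw).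
    pose proof (den_pos _ _ _ Hw Hx) as Hd.
    unfold Rminus. rewrite Rpower_plus, (Rpower_Ropp _ (INR nu)), Rpower_pow by easy.
    pose proof (exp_pos (- (2 * s) * ln (den w x))) as He.
    fold (Rpower (den w x) (- (2 * s))) in He.
    replace (r ^ nu * (Rpower (den w x) (- (2 * s)) * k w))
      with (k w * (r ^ nu * Rpower (den w x) (- (2 * s)))) by ring.
    apply Rmult_le_compat_l; [easy|].
    replace (bc w ^ nu * (Rpower (den w x) (- (2 * s)) * / den w x ^ nu))
      with (bc w ^ nu / den w x ^ nu * Rpower (den w x) (- (2 * s)))
      by (unfold Rdiv; ring).
    apply Rmult_le_compat_r; [lra|].
    apply Rle_div_l; [now apply pow_lt|]. rewrite <- Rpow_mult_distr.
    now apply pow_incr.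
Qed.

Lemma c_le_2den n w x : good gamma n w -> - (1/2) <= x -> bc w <= 2 * den w x.
Proof.
  intros Hw Hx. pose proof (den_ge_half _ _ _ Hw Hx).
  pose proof (c_le_d _ _ Hw). lra.
Qed.

Lemma c_le_den_gamma n w x : good gamma n w -> 0 <= x -> bc w <= / gamma * den w x.
Proof.
  intros Hw Hx. destruct Hw as [H1 _ _ H4 _ _ _ _ _ _ _]. unfold den.
  rewrite Rmult_comm. apply Rle_div_r; [lra|]. nra.
Qed.

Lemma weight_wder n x : weight n x = wder (fun _ => 1) n 0 x.
Proof. now rewrite wder_0. Qed.

(** * The eigenfunction *)

(** The growth rate of [weight n 0]; its existence comes from [growth_rate]. *)
Variable lam : R.
Hypothesis Hl : 0 < lam.
Hypothesis Hrate : forall n, kappa * weight n 0 <= lam ^ n <= weight n 0.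

Lemma lam_pow_pos n : 0 < lam ^ n.
Proof. now apply pow_lt. Qed.

(** The numerator compares points of [[-1/2, oo)] with 0, and [kappa] compares [weight n 0] with
    [lam ^ n]. *)
Definition wbound : R := Rpower 2 (2 * s) / kappa.

Lemma wbound_pos : 0 < wbound.
Proof. apply Rdiv_lt_0_compat; [apply exp_pos|apply kappa_pos]. Qed.

Lemma weight_le n x : - (1/2) <= x -> weight n x <= wbound * lam ^ n.
Proof.
  intros Hx. apply Rle_trans with (Rpower 2 (2 * s) * weight n 0).
  - apply weight_compare; lra.
  - unfold wbound, Rdiv. rewrite Rmult_assoc. apply Rmult_le_compat_l; [left; apply exp_pos|].
    rewrite Rmult_comm. apply Rle_div_r; [apply kappa_pos|].
    rewrite Rmult_comm. apply Hrate.
Qed.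

(** * Normalized weights and their upper limit *)

Definition nweight (n : nat) (x : R) : R := weight n x / lam ^ n.

Lemma nweight_le n x : - (1/2) <= x -> nweight n x <= wbound.
Proof. intros Hx. apply Rle_div_l; [apply lam_pow_pos|]. now apply weight_le. Qed.

Lemma nweight_ge n x : - (1/2) <= x -> / Rpower (2 + x) (2 * s) <= nweight n x.
Proof.
  intros Hx. apply Rle_div_r; [apply lam_pow_pos|].
  rewrite Rmult_comm. apply Rle_div_l; [apply exp_pos|].
  rewrite Rmult_comm. eapply Rle_trans; [apply Hrate|].
  apply weight_compare; lra.
Qed.

(** The constant is [2 * s * 2 * wbound], from [wder_bound] at order 1 with [r = 2]. *)
Lemma nweight_lip n x y : - (1/2) <= x -> - (1/2) <= y ->
  Rabs (nweight n y - nweight n x) <= 4 * s * wbound * Rabs (y - x).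
Proof.
  intros Hx Hy. pose proof (lam_pow_pos n) as Lp.
  replace (nweight n y - nweight n x) with ((weight n y - weight n x) / lam ^ n)
    by (unfold nweight; field; lra).
  unfold Rdiv. rewrite Rabs_mult, (Rabs_pos_eq (/ _))
    by (left; now apply Rinv_0_lt_compat).
  apply Rle_div_l; [easy|].
  replace (4 * s * wbound * Rabs (y - x) * lam ^ n)
    with (4 * s * wbound * lam ^ n * Rabs (y - x)) by ring.
  rewrite !weight_wder. pose proof (Rmin_glb x y _ Hx Hy).
  apply (MVT_bound _ (wder (fun _ => 1) n 1)); intros z Hz.
  - apply is_derive_wder. lra.
  - destruct (wder_bound (fun _ => 1) n 1 z 2) as [W1 W2]; [intros; lra| |lra|].
    { intros w Hw. apply (c_le_2den n); [now apply words_good|lra]. }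
    rewrite <- weight_wder in W2. pose proof (weight_le n z ltac:(lra)).
    rewrite <- (Rabs_pos_eq _ W1) in W2.
    rewrite Rabs_mult, pow_1, (Rabs_left (-1)) in W2 by lra.
    cbn [rising INR] in W2. nra.
Qed.

Definition hsup (x : R) : R := real (LimSup_seq (fun n => nweight n x)).

Lemma hsup_spec x : - (1/2) <= x ->
  is_LimSup_seq (fun n => nweight n x) (hsup x) /\ / Rpower (2 + x) (2 * s) <= hsup x <= wbound.
Proof.
  intros Hx. apply LimSup_bounded. intros n. split; [now apply nweight_ge|now apply nweight_le].
Qed.

Lemma hsup_pos x : - (1/2) <= x -> 0 < hsup x.
Proof.
  intros Hx. destruct (hsup_spec x Hx) as [_ [H _]].
  eapply Rlt_le_trans; [|exact H]. apply Rinv_0_lt_compat, exp_pos.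
Qed.

Lemma hsup_lip x y : - (1/2) <= x -> - (1/2) <= y ->
  Rabs (hsup x - hsup y) <= 4 * s * wbound * Rabs (x - y).
Proof.
  intros Hx Hy. apply Rabs_le_between'. split.
  - enough (hsup y <= hsup x + 4 * s * wbound * Rabs (x - y)) by lra.
    apply (LimSup_le_shift (fun n => nweight n y) (fun n => nweight n x)); try now apply hsup_spec.
    intros n. pose proof (nweight_lip n y x Hy Hx) as H. apply Rabs_le_between in H. lra.
  - apply (LimSup_le_shift (fun n => nweight n x) (fun n => nweight n y)); try now apply hsup_spec.
    intros n. pose proof (nweight_lip n y x Hy Hx) as H. apply Rabs_le_between in H. lra.
Qed.

Lemma nweight_S n x : - (1/2) <= x -> lam * nweight (S n) x = Lambda B s (nweight n) x.
Proof.
  intros Hx. pose proof (lam_pow_pos n). unfold nweight at 1, weight.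
  rewrite iter_S by easy.
  rewrite (Lambda_ext (nweight n) (fun y => / lam ^ n * weight n y))
    by (intros; unfold nweight, Rdiv; ring).
  rewrite Lambda_scal. cbn [pow].
  change (iter B s n (fun _ => 1)) with (weight n). field. lra.
Qed.

(** An upper limit of a finite sum is at most the sum of the upper limits. Only an inequality
    results, because different branches may approach their upper limits along different indices. *)
Lemma hsup_super x : - (1/2) <= x -> lam * hsup x <= Lambda B s hsup x.
Proof.
  intros Hx. apply le_epsilon. intros e He.
  set (S1 := Lambda B s (fun _ => 1) x).
  assert (HS : 0 <= S1).
  { apply sumL_nonneg. intros b _. rewrite Rmult_1_r. left; apply exp_pos. }
  (* The error [d] enters once through [Lambda], with factor [S1], and once through
     [lam * hsup x]. *)
  set (d := e / (S1 + lam)).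
  assert (Hd : 0 < d) by (apply Rdiv_lt_0_compat; lra).
  assert (Ed : d * S1 + lam * d = e) by (unfold d; field; lra).
  destruct (eventually_forall_in
    (fun b n => nweight n (/ (x + b)) <= hsup (/ (x + b)) + d) B) as [N HN].
  { intros b Hb. pose proof (inv_branch_range x b Hb Hx) as [Hi _].
    destruct (hsup_spec (/ (x + b)) ltac:(lra)) as [Hlim _].
    destruct (Hlim (mkposreal d Hd)) as [_ [N HN]].
    exists N. intros n Hn. left. now apply HN. }
  destruct (hsup_spec x Hx) as [Hlim _].
  destruct (Hlim (mkposreal d Hd)) as [Hinf _].
  (* An index beyond [S N] is a successor [S n] with [n >= N], as [nweight_S] requires. *)
  destruct (Hinf (S N)) as [[|n] [Hn Hun]]; [lia|]. cbn in Hun.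
  assert (H : Lambda B s (nweight n) x <= Lambda B s hsup x + d * S1).
  { unfold S1. rewrite <- Lambda_scal.
    unfold Lambda. change (fold_right Rplus 0 (map ?f ?L)) with (sumL f L).
    change (fold_right Rplus 0 (map ?f ?L)) with (sumL f L).
    rewrite <- sumL_plus. apply sumL_le. intros b Hb.
    rewrite <- Rmult_plus_distr_l, Rmult_1_r. apply Rmult_le_compat_l.
    - left; apply exp_pos.
    - apply HN; [lia|easy]. }
  rewrite <- nweight_S in H by easy. nra.
Qed.

Lemma iter_hsup_super n x : - (1/2) <= x -> lam * iter B s n hsup x <= iter B s (S n) hsup x.
Proof.
  revert x; induction n as [|n IH]; intros x Hx.
  - rewrite iter_S by easy. rewrite iter_0.
    rewrite (Lambda_ext (iter B s 0 hsup) hsup) by (intros; apply iter_0).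
    now apply hsup_super.
  - rewrite !(iter_S (S n)), iter_S, <- Lambda_scal by easy.
    apply Lambda_le. intros b Hb. apply IH.
    pose proof (inv_branch_range x b Hb Hx). lra.
Qed.

Definition eigf (x : R) : R := real (Lim_seq (fun n => iter B s n hsup x / lam ^ n)).

Lemma iter_hsup_incr x n : - (1/2) <= x ->
  iter B s n hsup x / lam ^ n <= iter B s (S n) hsup x / lam ^ S n.
Proof.
  intros Hx. pose proof (lam_pow_pos n) as Ln. pose proof (lam_pow_pos (S n)) as LSn.
  apply (Rle_div_r _ _ (lam ^ S n) LSn). pose proof (iter_hsup_super n x Hx).
  replace (iter B s n hsup x / lam ^ n * lam ^ S n) with (lam * iter B s n hsup x)
    by (cbn [pow]; field; lra).
  easy.
Qed.

Lemma eigf_lim x : - (1/2) <= x -> is_lim_seq (fun n => iter B s n hsup x / lam ^ n) (eigf x).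
Proof.
  intros Hx. apply Lim_seq_correct', ex_finite_lim_seq_incr with (wbound * wbound).
  - intros n. now apply iter_hsup_incr.
  - intros n. pose proof (lam_pow_pos n) as Ln. pose proof wbound_pos.
    apply Rle_div_l; [easy|]. apply Rle_trans with (wbound * weight n x).
    + unfold weight. rewrite <- iter_const. apply iter_le. intros w Hw.
      apply hsup_spec, (mob_ge_half n); [now apply words_good|easy].
    + rewrite Rmult_assoc. apply Rmult_le_compat_l; [lra|]. now apply weight_le.
Qed.

Lemma eigf_pos x : - (1/2) <= x -> 0 < eigf x.
Proof.
  intros Hx. apply Rlt_le_trans with (hsup x); [now apply hsup_pos|].
  pose proof (is_lim_seq_incr_compare _ _ (eigf_lim x Hx)
    (fun n => iter_hsup_incr x n Hx) 0%nat) as H.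
  cbn beta in H. rewrite iter_0, pow_O, Rdiv_1_r in H. exact H.
Qed.

(** Applying [Lambda] to the sequence defining [eigf] shifts it by one index and multiplies it by
    [lam]; both sides are limits of the same sequence. *)
Lemma eigf_eig x : - (1/2) <= x -> Lambda B s eigf x = lam * eigf x.
Proof.
  intros Hx.
  assert (H1 : is_lim_seq (fun n => Lambda B s (fun y => iter B s n hsup y / lam ^ n) x)
    (Lambda B s eigf x)).
  { apply (is_lim_seq_sumL
      (fun n b => Rpower (x + b) (- (2 * s)) * (iter B s n hsup (/ (x + b)) / lam ^ n))
      (fun b => Rpower (x + b) (- (2 * s)) * eigf (/ (x + b)))).
    intros b Hb. pose proof (inv_branch_range x b Hb Hx) as [Hi _].
    apply is_lim_seq_mult'; [apply is_lim_seq_const|]. apply eigf_lim. lra. }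
  assert (H2 : is_lim_seq (fun n => lam * (iter B s (S n) hsup x / lam ^ S n)) (lam * eigf x)).
  { apply is_lim_seq_mult'; [apply is_lim_seq_const|].
    apply -> (is_lim_seq_incr_1 (fun n => iter B s n hsup x / lam ^ n)). now apply eigf_lim. }
  apply is_lim_seq_unique in H1. apply is_lim_seq_unique in H2.
  rewrite (Lim_seq_ext _ (fun n => lam * (iter B s (S n) hsup x / lam ^ S n))) in H1.
  - rewrite H1 in H2. now injection H2.
  - intros n. pose proof (lam_pow_pos n).
    rewrite (Lambda_ext _ (fun y => / lam ^ n * iter B s n hsup y))
      by (intros; unfold Rdiv; ring).
    rewrite Lambda_scal, iter_S by easy. cbn [pow]. field. lra.
Qed.

(** * Smooth approximations and the derivatives of the eigenfunction *)

Definition approx (n nu : nat) (x : R) : R := wder (fun w => hsup (mob w 0)) n nu x / lam ^ n.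

(** Freezing [hsup] at the image of 0 makes each term smooth although [hsup] is only known to be
    Lipschitz. The images of 0 and [x] are within [4 * Rabs x / INR n], so the replacement costs at
    most [C / INR n]. *)
Lemma approx_lim x : - (1/2) <= x -> is_lim_seq (fun n => approx n 0 x) (eigf x).
Proof.
  intros Hx.
  set (C := wbound * (4 * s * wbound * (4 * Rabs x))).
  apply is_lim_seq_ext with
    (fun n => (approx n 0 x - iter B s n hsup x / lam ^ n) + iter B s n hsup x / lam ^ n);
    [intros; ring|].
  replace (eigf x) with (0 + eigf x) by ring.
  apply is_lim_seq_plus'; [|now apply eigf_lim].
  (* The index is shifted so that the error bound never divides by [INR 0]. *)
  apply is_lim_seq_abs_0, is_lim_seq_incr_1.
  apply is_lim_seq_le_le with (fun _ => 0) (fun n => C * / INR (S n)).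
  - intros n. split; [apply Rabs_pos|].
    pose proof (lam_pow_pos (S n)) as Lp. pose proof wbound_pos as Mp.
    pose proof (lt_0_INR (S n) ltac:(lia)) as Np.
    unfold approx. rewrite wder_0. unfold iter.
    match goal with |- Rabs (?X / ?L - ?Y / ?L) <= _ =>
      replace (X / L - Y / L) with ((X + -1 * Y) / L) by (field; lra) end.
    rewrite <- sumL_scal, <- sumL_plus.
    unfold Rdiv. rewrite Rabs_mult, (Rabs_pos_eq (/ _))
      by (left; now apply Rinv_0_lt_compat).
    apply Rle_div_l; [easy|]. eapply Rle_trans; [apply sumL_abs|].
    apply Rle_trans with (4 * s * wbound * (4 * Rabs x) * / INR (S n) * weight (S n) x).
    + rewrite weight_eq, <- sumL_scal. apply sumL_le. intros w Hw. apply words_good in Hw.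
      pose proof (exp_pos (- (2 * s) * ln (den w x))) as Ep.
      fold (Rpower (den w x) (- (2 * s))) in Ep.
      replace (Rpower (den w x) (- (2 * s)) * hsup (mob w 0) +
               -1 * (Rpower (den w x) (- (2 * s)) * hsup (mob w x)))
        with (Rpower (den w x) (- (2 * s)) * (hsup (mob w 0) - hsup (mob w x))) by ring.
      rewrite Rabs_mult, (Rabs_pos_eq (Rpower _ _)), Rmult_comm by lra.
      apply Rmult_le_compat_r; [lra|].
      eapply Rle_trans.
      { apply hsup_lip; apply (mob_ge_half (S n)); (easy || lra). }
      rewrite (Rmult_assoc (4 * s * wbound)). apply Rmult_le_compat_l; [nra|].
      apply (Rle_div_r _ _ (INR (S n)) Np). rewrite Rmult_comm.
      replace (Rabs x) with (Rabs (0 - x)) by (rewrite Rminus_0_l; apply Rabs_Ropp).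
      apply mob_dist; (easy || lra).
    + pose proof (weight_le (S n) x Hx) as HF.
      replace (C * / INR (S n) * lam ^ S n)
        with (4 * s * wbound * (4 * Rabs x) * / INR (S n) * (wbound * lam ^ S n))
        by (unfold C; ring).
      apply Rmult_le_compat_l; [|easy].
      pose proof (Rabs_pos x). pose proof (Rinv_0_lt_compat _ Np).
      apply Rmult_le_pos; [|lra]. apply Rmult_le_pos; [|lra]. nra.
  - apply is_lim_seq_const.
  - replace (Finite 0) with (Rbar_mult C 0) by (cbn; now rewrite Rmult_0_r).
    apply is_lim_seq_scal_l. apply -> (is_lim_seq_incr_1 (fun n => / INR n)).
    apply (is_lim_seq_inv INR p_infty); [apply is_lim_seq_INR|easy].
Qed.

Lemma is_derive_approx n k x : - (1/2) <= x ->
  is_derive (approx n k) x (approx n (S k) x).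
Proof.
  intros Hx. unfold approx, Rdiv.
  apply (is_derive_ext (fun y => / lam ^ n * wder (fun w => hsup (mob w 0)) n k y));
    [intros; apply Rmult_comm|].
  rewrite Rmult_comm. now apply is_derive_scal, is_derive_wder.
Qed.

Lemma approx_bound n k x r : - (1/2) <= x ->
  (forall w, In w (words B n) -> bc w <= r * den w x) ->
  0 <= (-1) ^ k * approx n k x <= rising (2 * s) k * r ^ k * approx n 0 x.
Proof.
  intros Hx Hr. pose proof (lam_pow_pos n) as Lp.
  destruct (wder_bound (fun w => hsup (mob w 0)) n k x r) as [W1 W2]; try easy.
  { intros w Hw. left. apply hsup_pos, (mob_ge_half n); [now apply words_good|lra]. }
  unfold approx, Rdiv. rewrite <- !Rmult_assoc.
  pose proof (Rinv_0_lt_compat _ Lp). split.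
  - apply Rmult_le_pos; lra.
  - apply Rmult_le_compat_r; lra.
Qed.

Lemma approx0_le n x : - (1/2) <= x -> 0 <= approx n 0 x <= wbound * wbound.
Proof.
  intros Hx. pose proof (lam_pow_pos n) as Lp. unfold approx. rewrite wder_0.
  assert (H : forall w, In w (words B n) -> 0 < hsup (mob w 0) <= wbound).
  { intros w Hw. apply words_good in Hw.
    assert (- (1/2) <= mob w 0) by (apply (mob_ge_half n); [easy|lra]).
    split; [now apply hsup_pos|now apply hsup_spec]. }
  split.
  - apply Rmult_le_pos; [|left; now apply Rinv_0_lt_compat].
    apply sumL_nonneg. intros w Hw. specialize (H w Hw).
    apply Rmult_le_pos; [left; apply exp_pos|lra].
  - apply Rle_div_l; [easy|]. apply Rle_trans with (wbound * weight n x).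
    + rewrite weight_eq, <- sumL_scal. apply sumL_le. intros w Hw. specialize (H w Hw).
      rewrite Rmult_comm. apply Rmult_le_compat_r; [left; apply exp_pos|lra].
    + rewrite Rmult_assoc. apply Rmult_le_compat_l; [left; apply wbound_pos|].
      now apply weight_le.
Qed.

Lemma approx_abs_le n k x : - (1/2) <= x ->
  Rabs (approx n k x) <= rising (2 * s) k * 2 ^ k * (wbound * wbound).
Proof.
  intros Hx. destruct (approx_bound n k x 2 Hx) as [A1 A2].
  { intros w Hw. apply (c_le_2den n); [now apply words_good|easy]. }
  rewrite <- (Rabs_pos_eq _ A1), Rabs_mult, pow_1_abs, Rmult_1_l in A2.
  eapply Rle_trans; [exact A2|]. apply Rmult_le_compat_l; [|now apply approx0_le].
  apply Rmult_le_pos; [left; apply rising_pos; lra|apply pow_le; lra].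
Qed.

Definition eigder (k : nat) (x : R) : R := real (Lim_seq (fun n => approx n k x)).

(** The bounds of [approx_abs_le] do not depend on [n], so [lim_derivs] applies on the open
    half-line. *)
Lemma eigder_spec k x : - (1/2) < x ->
  is_lim_seq (fun n => approx n k x) (eigder k x) /\
  is_derive (eigder k) x (eigder (S k) x).
Proof.
  apply (lim_derivs approx (fun k => rising (2 * s) k * 2 ^ k * (wbound * wbound))).
  - intros n j y Hy. apply is_derive_approx. lra.
  - intros n j y Hy. apply approx_abs_le. lra.
  - intros y Hy. exists (eigf y). apply approx_lim. lra.
Qed.

Lemma eigder_0 x : - (1/2) < x -> eigder 0 x = eigf x.
Proof.
  intros Hx. unfold eigder. rewrite (is_lim_seq_unique _ _ (approx_lim x ltac:(lra))).
  reflexivity.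
Qed.

Lemma eigder_bound nu x : 0 <= x ->
  0 <= (-1) ^ nu * eigder nu x <= rising (2 * s) nu * / gamma ^ nu * eigf x.
Proof.
  intros Hx.
  assert (L : is_lim_seq (fun n => (-1) ^ nu * approx n nu x) ((-1) ^ nu * eigder nu x)).
  { apply is_lim_seq_mult'; [apply is_lim_seq_const|]. apply eigder_spec. lra. }
  assert (A : forall n, 0 <= (-1) ^ nu * approx n nu x
    <= rising (2 * s) nu * (/ gamma) ^ nu * approx n 0 x).
  { intros n. apply approx_bound; [lra|].
    intros w Hw. apply (c_le_den_gamma n); [now apply words_good|easy]. }
  rewrite <- pow_inv. split.
  - eapply lim_seq_le_real; [|apply is_lim_seq_const|exact L]. apply A.
  - eapply lim_seq_le_real; [intros n; apply A|exact L|].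
    apply is_lim_seq_mult'; [apply is_lim_seq_const|]. apply approx_lim. lra.
Qed.

Lemma Derive_n_eigf k x : - (1/2) < x -> Derive_n eigf k x = eigder k x.
Proof.
  revert x; induction k as [|k IH]; intros x Hx.
  - cbn. now rewrite eigder_0.
  - cbn [Derive_n]. rewrite (Derive_ext_loc _ (eigder k)).
    + apply is_derive_unique, eigder_spec, Hx.
    + apply (filter_imp (fun y => - (1/2) < y)); [exact IH|]. now apply (open_gt (- (1/2))).
Qed.

Lemma ex_derive_eigf k x : - (1/2) < x -> ex_derive (Derive_n eigf k) x.
Proof.
  intros Hx. apply (ex_derive_ext_loc (eigder k)).
  - apply (filter_imp (fun y => - (1/2) < y)); [|now apply (open_gt (- (1/2)))].
    intros y Hy. now rewrite Derive_n_eigf.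
  - exists (eigder (S k) x). now apply eigder_spec.
Qed.

Lemma Derive_n_eigf_continuous k x : - (1/2) < x -> continuous (Derive_n eigf k) x.
Proof.
  intros Hx. apply (ex_derive_continuous (K := R_AbsRing) (V := R_NormedModule)).
  now apply ex_derive_eigf.
Qed.

Lemma Derive_n_eigf_cont_on_closed a k : cont_on_closed a (Derive_n eigf k).
Proof.
  intros x [Hx _].
  apply (filterlim_filter_le_1 (F := locally x)); [apply filter_le_within|].
  apply Derive_n_eigf_continuous. lra.
Qed.

Lemma eigf_CmBar a m : CmBar a m eigf.
Proof.
  split; [|split].
  - intros k _ x [Hx _]. apply ex_derive_eigf. lra.
  - apply (Derive_n_eigf_cont_on_closed a 0).
  - intros k _. exists (Derive_n eigf k). split; [apply Derive_n_eigf_cont_on_closed|easy].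
Qed.

(** * Uniqueness *)

(** The equation on [[0, a]] is enough, as every inverse branch maps [[0, a]] into [[0, 1]], which
    lies in [[0, a]]. *)
Lemma iter_eig a mu f n x :
  1 <= a -> (forall y, inClosed a y -> Lambda B s f y = mu * f y) -> inClosed a x ->
  iter B s n f x = mu ^ n * f x.
Proof.
  intros Ha Hf. revert x; induction n as [|n IH]; intros x Hx.
  - rewrite iter_0, pow_O. ring.
  - rewrite iter_S by (unfold inClosed in Hx; lra).
    rewrite (Lambda_ext _ (fun y => mu ^ n * f y)).
    + rewrite Lambda_scal, Hf by easy. cbn [pow]. ring.
    + intros b Hb. apply IH. unfold inClosed in *.
      pose proof (inv_branch_range x b Hb ltac:(lra)). lra.
Qed.

Lemma mob_inClosed n a w x :
  In w (words B n) -> 1 <= a -> inClosed a x -> inClosed a (mob w x).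
Proof.
  intros Hw Ha Hx. apply words_good in Hw. unfold inClosed in *. split.
  - now apply (mob_nonneg n).
  - now apply (mob_le n).
Qed.

(* Positivity squeezes [mu ^ n] between multiples of the total weight, hence of [lam ^ n]. *)
Lemma eigenvalue_unique a mu f c C :
  1 <= a -> 0 < c -> (forall y, inClosed a y -> c <= f y <= C) ->
  (forall y, inClosed a y -> Lambda B s f y = mu * f y) -> mu = lam.
Proof.
  intros Ha Hc Hf Hmu.
  assert (H0 : inClosed a 0) by (unfold inClosed; lra).
  pose proof (Hf 0 H0) as Hf0.
  assert (Pmu : 0 < mu).
  { apply (Rmult_lt_reg_r (f 0)); [lra|]. rewrite Rmult_0_l, <- Hmu by easy.
    apply sumL_pos; [easy|]. intros b Hb.
    pose proof (inv_branch_range 0 b Hb ltac:(lra)).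
    apply Rmult_lt_0_compat; [apply exp_pos|].
    apply Rlt_le_trans with c; [easy|]. apply Hf. unfold inClosed. lra. }
  assert (Hn : forall n, c * weight n 0 <= mu ^ n * f 0 <= C * weight n 0).
  { intros n. rewrite <- (iter_eig a) by easy. unfold weight. rewrite <- !iter_const.
    split; apply iter_le; intros w Hw; apply Hf, (mob_inClosed n); easy. }
  apply Rle_antisym.
  - apply (pow_growth_le mu lam (f 0) (C * wbound)); try lra.
    intros n. rewrite Rmult_comm. eapply Rle_trans; [apply Hn|]. rewrite Rmult_assoc.
    apply Rmult_le_compat_l; [lra|]. apply weight_le. lra.
  - apply (pow_growth_le lam mu c (f 0)); try lra.
    intros n. rewrite (Rmult_comm (f 0)). eapply Rle_trans; [|apply Hn].
    apply Rmult_le_compat_l; [lra|]. apply Hrate.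
Qed.

(** In the expansion of [lam ^ n * q x] over words, each weight is comparable to that at [x0], and
    each value of [q] is close to the one at the image of [x0]. The sum at [x0] equals
    [lam ^ n * q x0 = 0], so only the small error remains. *)
Lemma nonneg_eigfunction_vanishes a q x0 :
  1 <= a -> (forall x, inClosed a x -> continuity_pt q x) ->
  (forall x, inClosed a x -> 0 <= q x) ->
  (forall x, inClosed a x -> Lambda B s q x = lam * q x) ->
  inClosed a x0 -> q x0 = 0 -> forall x, inClosed a x -> q x = 0.
Proof.
  intros Ha Hcont Hpos Heig Hx0 Hq0 x Hx.
  apply Rle_antisym; [|now apply Hpos].
  apply le_epsilon. intros e He. rewrite Rplus_0_l.
  pose proof wbound_pos as Mp.
  assert (He' : 0 < e / wbound) by now apply Rdiv_lt_0_compat.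
  destruct (@Heine_cor2 q 0 a Hcont (mkposreal _ He')) as [[d Hd] Huni].
  cbn in Huni.
  (* At this depth [mob_dist] brings the images of any two points of [[0, a]] within [d], the
     modulus of uniform continuity for [e / wbound]. *)
  destruct (INR_unbounded (4 * a / d)) as [n Hn].
  apply (Rlt_div_l _ _ _ Hd) in Hn.
  assert (Np : 0 < INR n) by nra.
  pose proof (lam_pow_pos n) as Lp.
  apply (Rmult_le_reg_l (lam ^ n)); [easy|].
  rewrite <- (iter_eig a) by easy.
  apply Rle_trans with (Rpower (1 + a) (2 * s) * iter B s n q x0 + e / wbound * weight n x).
  - rewrite weight_eq. unfold iter. rewrite <- !sumL_scal, <- sumL_plus.
    apply sumL_le. intros w Hw.
    pose proof (mob_inClosed n a w x Hw Ha Hx) as Mx.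
    pose proof (mob_inClosed n a w x0 Hw Ha Hx0) as Mx0.
    apply words_good in Hw. unfold inClosed in Hx, Hx0.
    assert (D : Rabs (mob w x - mob w x0) < d).
    { pose proof (mob_dist n w x x0 Hw ltac:(lra) ltac:(lra)) as D.
      assert (Rabs (x - x0) <= a) by (apply Rabs_le_between; lra).
      apply (Rmult_lt_reg_l (INR n)); [easy|]. lra. }
    specialize (Huni _ _ Mx Mx0 D). apply Rabs_def2 in Huni.
    (* The factor comes from [den w x0 <= (1 + a) * bd w <= (1 + a) * den w x]. *)
    assert (P : Rpower (den w x) (- (2 * s))
      <= Rpower (1 + a) (2 * s) * Rpower (den w x0) (- (2 * s))).
    { apply Rpower_neg_compare; try lra; try (apply (den_pos n); [easy|lra]).
      pose proof (c_le_d _ _ Hw). pose proof (good_c _ _ _ Hw) as Hc.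
      assert (bc w * x0 <= bc w * a) by (apply Rmult_le_compat_l; lra).
      assert (bc w * a <= bd w * a) by (apply Rmult_le_compat_r; lra).
      assert (0 <= bc w * x) by (apply Rmult_le_pos; lra).
      assert (0 <= a * (bc w * x)) by (apply Rmult_le_pos; lra).
      unfold den. lra. }
    pose proof (exp_pos (- (2 * s) * ln (den w x))) as Ep.
    fold (Rpower (den w x) (- (2 * s))) in Ep.
    apply Rle_trans with (Rpower (den w x) (- (2 * s)) * (q (mob w x0) + e / wbound)).
    + apply Rmult_le_compat_l; lra.
    + rewrite Rmult_plus_distr_l, <- Rmult_assoc, (Rmult_comm (e / wbound)).
      apply Rplus_le_compat_r, Rmult_le_compat_r; [now apply Hpos|easy].
  - rewrite (iter_eig a lam q n x0), Hq0, !Rmult_0_r, Rplus_0_l by easy.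
    apply Rle_trans with (e / wbound * (wbound * lam ^ n)).
    + apply Rmult_le_compat_l; [lra|]. apply weight_le. unfold inClosed in Hx; lra.
    + right. field. lra.
Qed.

Lemma eigf_unique a m w : 1 <= a -> pos_eigvec B s a m w ->
  exists c, 0 < c /\ forall x, inClosed a x -> w x = c * eigf x.
Proof.
  intros Ha [[_ [Hw _]] [Pw [mu Hmu]]].
  set (wc := fun x => w (clamp a x)). set (vc := fun x => eigf (clamp a x)).
  assert (Cw : forall x, continuity_pt wc x)
    by (intros x; apply clamp_continuous; [lra|easy]).
  assert (Cv : forall x, continuity_pt vc x)
    by (intros x; apply clamp_continuous;
        [lra|apply (Derive_n_eigf_cont_on_closed a 0)]).
  assert (Ew : forall x, inClosed a x -> wc x = w x)
    by (intros x Hx; unfold wc; now rewrite clamp_id).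
  assert (Ev : forall x, inClosed a x -> vc x = eigf x)
    by (intros x Hx; unfold vc; now rewrite clamp_id).
  assert (Pv : forall x, inClosed a x -> 0 < eigf x)
    by (intros x [Hx _]; apply eigf_pos; lra).
  assert (Br : forall x b, inClosed a x -> In b B -> inClosed a (/ (x + b))).
  { intros x b [Hx Hxa] Hb. pose proof (inv_branch_range x b Hb ltac:(lra)).
    unfold inClosed. lra. }
  (* The extreme values of the clamped function on [[0, a]] provide the positive lower bound and the
     upper bound that [eigenvalue_unique] asks for. *)
  assert (Heq : mu = lam).
  { destruct (continuity_ab_min wc 0 a ltac:(lra) (fun x _ => Cw x)) as [x1 [H1 I1]].
    destruct (continuity_ab_maj wc 0 a ltac:(lra) (fun x _ => Cw x)) as [x2 [H2 I2]].
    apply (eigenvalue_unique a mu w (wc x1) (wc x2)); try easy.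
    - rewrite Ew by easy. now apply Pw.
    - intros y Hy. rewrite <- (Ew y Hy). split; [now apply H1|now apply H2]. }
  destruct (continuity_ab_min (fun x => wc x / vc x) 0 a ltac:(lra)) as [x0 [Hmin I0]].
  { intros x Hx. apply (continuity_pt_div wc vc); try easy.
    rewrite Ev by easy. specialize (Pv x Hx). lra. }
  set (c := wc x0 / vc x0) in *.
  assert (Pc : 0 < c).
  { unfold c. rewrite Ew, Ev by easy. apply Rdiv_lt_0_compat; [now apply Pw|now apply Pv]. }
  exists c. split; [easy|]. intros x Hx.
  enough (H : wc x - c * vc x = 0) by (rewrite Ew, Ev in H by easy; lra).
  apply (nonneg_eigfunction_vanishes a (fun x => wc x - c * vc x) x0); try easy.
  - intros y _. apply (continuity_pt_minus wc (mult_real_fct c vc)); [easy|].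
    now apply continuity_pt_scal.
  - intros y Hy. specialize (Hmin y Hy). specialize (Pv y Hy).
    rewrite <- Ev in Pv by easy. apply (Rle_div_r _ _ (vc y) Pv) in Hmin. lra.
  - intros y Hy.
    (* [Lambda] at a point of [[0, a]] evaluates its argument only inside [[0, a]], where clamping
       changes nothing. *)
    replace (Lambda B s (fun z => wc z - c * vc z) y)
      with (Lambda B s w y + (- c) * Lambda B s eigf y).
    + rewrite Hmu, eigf_eig, Heq, Ew, Ev by (easy || (unfold inClosed in Hy; lra)). ring.
    + rewrite <- Lambda_scal. unfold Lambda.
      repeat change (fold_right Rplus 0 (map ?f ?L)) with (sumL f L).
      rewrite <- sumL_plus. apply sumL_ext. intros b Hb.
      rewrite Ew, Ev by now apply Br. ring.
  - unfold c. rewrite Ew, Ev by easy. specialize (Pv x0 I0). field. lra.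
Qed.

End Transfer.

Theorem theorem7p14 (gamma a : R) (B : list R) (m : nat) :
  1 <= gamma ->
  B <> nil -> NoDup B -> List.Forall (fun b => gamma <= b) B ->
  gamma <= a ->
  (0 < m)%nat ->
  forall s : R, 0 < s ->
  exists v : R -> R,
    pos_eigvec B s a m v /\
    (* uniqueness up to normalization (positive scalar multiple) *)
    (forall w : R -> R, pos_eigvec B s a m w ->
       exists c, 0 < c /\ forall x, inClosed a x -> w x = c * v x) /\
    (* v is C^infinity on the closure of H *)
    (forall k : nat, CmBar a k v) /\
    (* derivative bounds on the closure of H *)
    (forall nu : nat, (1 <= nu)%nat ->
       exists g, deriv_ext a v nu g /\
         forall x, inClosed a x ->
           0 <= (-1) ^ nu * g x / v x <= rising (2 * s) nu / gamma ^ nu).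
Proof.
  intros Hg HB _ HBg Hga _ s Hs.
  (* The eigenvalue is the exponential growth rate of the total weights at 0. *)
  destruct (growth_rate (kappa s) (fun n => weight s B n 0)) as [lam [Hl Hrate]].
  - apply kappa_pos.
  - intros n. now apply weight_pos.
  - intros n k. now apply (weight0_submult gamma).
  - intros n k. now apply (weight0_supermult gamma).
  - exists (eigf s B lam). split; [|split; [|split]].
    + split; [now apply (eigf_CmBar gamma)|split].
      * intros x [Hx _]. apply (eigf_pos gamma); (easy || lra).
      * exists lam. intros x [Hx _]. apply (eigf_eig gamma); (easy || lra).
    + intros w Hw. apply (eigf_unique gamma s B Hg Hs HB HBg lam Hl Hrate a m w); (easy || lra).
    + intros k. now apply (eigf_CmBar gamma).
    (* The derivative is its own continuous extension: both endpoints of [[0, a]] are interior to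
       [(-1/2, oo)], where [eigf] is smooth. *)
    + intros nu _. exists (Derive_n (eigf s B lam) nu). split.
      * split; [now apply (Derive_n_eigf_cont_on_closed gamma)|easy].
      * intros x [Hx _].
        assert (Pv : 0 < eigf s B lam x) by (apply (eigf_pos gamma); (easy || lra)).
        rewrite (Derive_n_eigf gamma) by (easy || lra).
        destruct (eigder_bound gamma s B Hg Hs HBg lam Hl Hrate nu x Hx) as [E1 E2].
        split.
        -- apply Rmult_le_pos; [easy|]. left; now apply Rinv_0_lt_compat.
        -- apply Rle_div_l; [easy|]. exact E2.
Qed.
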